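(* Let $\bar x\in\mathbb{R}^n$ be a feasible point of the disjunctive problem $\min_x f(x)$ s.t. $F(x)\in\Gamma$. Then the following statements are equivalent. (a) There exists an approximately S-stationary sequence w.r.t. $\bar x$. (b) The point $\bar x$ is AM-stationary. (c) There exists a sequence $\{(x^k,\lambda^k,\varepsilon^k)\}_{k=1}^\infty\subset\mathbb{R}^n\times\mathbb{R}^\ell\times\mathbb{R}^n$ such that $(x^k,\varepsilon^k)\to(\bar x,0)$ and, for all $k\in\mathbb{N}$, $\varepsilon^k=\nabla f(x^k)+F'(x^k)^\top\lambda^k$ and $\lambda^k\in N_\Gamma(F(\bar x))$.
   Context: Here $f\colon\mathbb{R}^n\to\mathbb{R}$ and $F\colon\mathbb{R}^n\to\mathbb{R}^\ell$ are continuously differentiable, $\Gamma=\bigcup_{j=1}^t\Gamma_j$ with convex polyhedral sets $\Gamma_1,\dots,\Gamma_t\subset\mathbb{R}^\ell$, and $F'(x)$ is the Jacobian of $F$ at $x$. For a closed set $\Omega$ and $y\in\Omega$, the regular normal cone is $\widehat N_\Omega(y)=\{\xi\mid \forall z\in\Omega\colon \xi^\top(z-y)\le o(\|z-y\|)\}$; the limiting normal cone $N_\Omega(y)$ is the set of all limits of sequences $\xi^k\in\widehat N_\Omega(y^k)$ with $y^k\to y$, $y^k\in\Omega$. Both cones are set to $\emptyset$ for $y\notin\Omega$. Let $\bar x$ be feasible. A sequence $\{(x^k,\lambda^k,\delta^k,\varepsilon^k)\}_{k=1}^\infty\subset\mathbb{R}^n\times\mathbb{R}^\ell\times\mathbb{R}^\ell\times\mathbb{R}^n$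 with $(x^k,\delta^k,\varepsilon^k)\to(\bar x,0,0)$ and $\varepsilon^k=\nabla f(x^k)+F'(x^k)^\top\lambda^k$ for all $k\in\mathbb{N}$ is called approximately S-stationary w.r.t. $\bar x$ if $\lambda^k\in\widehat N_\Gamma(F(x^k)-\delta^k)$ for all $k$, and approximately M-stationary w.r.t. $\bar x$ if $\lambda^k\in N_\Gamma(F(x^k)-\delta^k)$ for all $k$. The point $\bar x$ is AM-stationary if there exists an approximately M-stationary sequence w.r.t. $\bar x$. *)

(* Defs.v *)
From HB Require Import structures.
From mathcomp Require Import all_boot all_order all_algebra.
From mathcomp Require Import all_classical all_reals all_analysis.

Set Implicit Arguments.
Unset Strict Implicit.
Unset Printing Implicit Defensive.

Import Order.TTheory GRing.Theory Num.Theory.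
Import numFieldNormedType.Exports.

Local Open Scope classical_set_scope.
Local Open Scope ring_scope.

(* Vectors of R^n are row vectors 'rV[R]_n.  Their library norm is the maximum
   norm; it only occurs in limits and in a little-o, where it can be exchanged
   with the Euclidean norm. *)

Section Calculus.
Context {R : realType} {n l : nat}.
Implicit Types (f : 'rV[R]_n -> R) (F : 'rV[R]_n -> 'rV[R]_l).

Definition dot (u v : 'rV[R]_n) : R := \sum_(i < n) u 0 i * v 0 i.

Definition gradient f (x : 'rV[R]_n) : 'rV[R]_n :=
  \row_(i < n) 'D_(delta_mx 0 i) f x.

(* The library's 'J F x acts on row vectors from the right, so that its
   (i, j) entry is the i-th partial derivative of F_j; the usual Jacobian
   F'(x) is its transpose. *)
Definition Jacobian F (x : 'rV[R]_n) : 'M[R]_(l, n) := ('J F x)^T.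

Definition C1_fun f : Prop :=
  (forall x, differentiable f x) /\ continuous (gradient f).

Definition C1_map F : Prop :=
  (forall x, differentiable F x) /\ continuous (Jacobian F).

End Calculus.

Section Cones.
Context {R : realType} {l : nat}.
Implicit Types (Omega : set 'rV[R]_l) (y : 'rV[R]_l).

Definition convex_polyhedral Omega : Prop :=
  exists (p : nat) (a : 'I_p -> 'rV[R]_l) (b : 'I_p -> R),
    Omega = [set y | forall i, dot (a i) y <= b i].

Definition regular_normal_cone Omega y : set 'rV[R]_l :=
  [set xi | Omega y /\
    exists2 r : 'rV[R]_l -> R, r =o_y (fun z => `|z - y|) &
      forall z, Omega z -> dot xi (z - y) <= r z].

Definition limiting_normal_cone Omega y : set 'rV[R]_l :=
  [set xi | Omega y /\
    exists yk xik : nat -> 'rV[R]_l,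
      [/\ yk @ \oo --> y,
          xik @ \oo --> xi,
          forall k, Omega (yk k) &
          forall k, regular_normal_cone Omega (yk k) (xik k)]].

End Cones.

Section Stationarity.
Context {R : realType} {n l : nat}.
Variables (f : 'rV[R]_n -> R) (F : 'rV[R]_n -> 'rV[R]_l).
Variable Gamma : set 'rV[R]_l.

(* eps = grad f(x) + F'(x)^T lambda; for row vectors the column F'(x)^T lambda
   becomes the row lambda F'(x). *)
Definition lagrange_residual (x : 'rV[R]_n) (lambda : 'rV[R]_l)
    (eps : 'rV[R]_n) : Prop :=
  eps = gradient f x + lambda *m Jacobian F x.

Definition approx_S_stationary_seq (xbar : 'rV[R]_n)
    (x : nat -> 'rV[R]_n) (lambda delta : nat -> 'rV[R]_l)
    (eps : nat -> 'rV[R]_n) : Prop :=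
  [/\ x @ \oo --> xbar, delta @ \oo --> (0 : 'rV[R]_l),
      eps @ \oo --> (0 : 'rV[R]_n),
      forall k, lagrange_residual (x k) (lambda k) (eps k) &
      forall k, regular_normal_cone Gamma (F (x k) - delta k) (lambda k)].

Definition approx_M_stationary_seq (xbar : 'rV[R]_n)
    (x : nat -> 'rV[R]_n) (lambda delta : nat -> 'rV[R]_l)
    (eps : nat -> 'rV[R]_n) : Prop :=
  [/\ x @ \oo --> xbar, delta @ \oo --> (0 : 'rV[R]_l),
      eps @ \oo --> (0 : 'rV[R]_n),
      forall k, lagrange_residual (x k) (lambda k) (eps k) &
      forall k, limiting_normal_cone Gamma (F (x k) - delta k) (lambda k)].

Definition AM_stationary (xbar : 'rV[R]_n) : Prop :=
  exists x lambda delta eps, approx_M_stationary_seq xbar x lambda delta eps.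

End Stationarity.

(* Main.v *)
Require Import Defs.
From HB Require Import structures.
From mathcomp Require Import all_boot all_order all_algebra.
From mathcomp Require Import all_classical all_reals all_analysis.
From mathcomp Require Import lra.
Import Order.TTheory GRing.Theory Num.Theory.
Import numFieldNormedType.Exports.
Local Open Scope classical_set_scope.
Local Open Scope ring_scope.

(** The three statements differ in the kind of normal (regular or limiting) and
    in its base point (near [F xbar] or at it).

    The kind of normal does not matter because a limiting normal is a limit of
    regular normals at nearby points. In the Lagrange residual the multiplier
    enters through the linear map [v |-> v *m Jacobian F (x k)], which is
    continuous; so, for each [k] separately, multiplier and base point can be
    replaced by a regular normal and its base point at a cost below
    [1 / (k + 1)] in both [delta k] and [eps k]
    ([regular_stationary_of_limiting]).

    The base point can be moved to [F xbar] because of the disjunctive structure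
    of [Gamma]. Around any point [y], whether inside it or not, a closed
    half-space is locally invariant under the homotheties with centre [y] and
    ratio [0 < s <= 1]. This property, called [locally_conic] below, passes to
    finite intersections and finite unions, hence to [Gamma]. A homothety scales
    inner products and norms alike, so a regular normal at a point [z] close to
    [y] is one at all points [y + s (z - y)] as well; these tend to [y] with [s]
    tending to 0, so the vector is a limiting normal at [y]
    ([regular_normal_near]). In an approximately S-stationary sequence the base
    points [F (x k) - delta k] converge to [F xbar], so the multipliers of a
    tail are limiting normals at [F xbar]. Conversely, for multipliers that are
    normal at [F xbar] one takes [delta k := F (x k) - F xbar], which tends to 0 by
    continuity of [F]. *)

(** * Continuity *)

Lemma cvg_sum_normed {K : numFieldType} {V : normedModType K} {T I : Type}
    {F : set_system T} (FF : Filter F) (r : seq I) (f : I -> T -> V)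
    (a : I -> V) :
  (forall i, f i @ F --> a i) ->
  \sum_(i <- r) f i x @[x --> F] --> \sum_(i <- r) a i.
Proof.
move=> fa; apply: cvg_big => [|i _]; first exact: add_continuous.
exact: fa.
Qed.

Section Dot.
Context {R : realType} {l : nat}.
Implicit Types u v w : 'rV[R]_l.

Lemma dotDr u v w : dot u (v + w) = dot u v + dot u w.
Proof.
by rewrite /dot -big_split; apply: eq_bigr => i _; rewrite mxE mulrDr.
Qed.

Lemma dotZr u v (s : R) : dot u (s *: v) = s * dot u v.
Proof.
by rewrite /dot mulr_sumr; apply: eq_bigr => i _; rewrite mxE mulrCA.
Qed.

Lemma dotBr u v w : dot u (v - w) = dot u v - dot u w.
Proof. by rewrite dotDr -scaleN1r dotZr mulN1r. Qed.

Lemma dot_continuous u : continuous (dot u).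
Proof.
move=> v; apply: (cvg_sum_normed (V := R^o) (nbhs_filter v)) => i.
by apply: cvgM; [exact: cvg_cst | exact: coord_continuous].
Qed.

End Dot.

Lemma mulmx_continuous (R : realType) (l n : nat) (A : 'M[R]_(l, n)) :
  continuous (fun v : 'rV[R]_l => v *m A).
Proof.
rewrite (_ : (fun v => _) =
    fun v : 'rV[R]_l => \sum_i v 0 i *: row i A); last first.
  by apply/funext => v; exact: mulmx_sum_row.
move=> v; apply: (cvg_sum_normed (nbhs_filter v)) => i.
by apply: cvgZr_tmp; exact: coord_continuous.
Qed.

Lemma dilation_continuous (K : numFieldType) (V : normedModType K) (y : V)
    (s : K) :
  continuous (fun w : V => y + s *: (w - y)).
Proof.
move=> z; apply: cvgD; first exact: cvg_cst.
by apply: cvgZl_tmp; apply: cvgB; [exact: cvg_id | exact: cvg_cst].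
Qed.

Lemma cvg0_harmonic_dist (R : realType) (V : normedModType R) (u v : nat -> V) :
  u @ \oo --> 0 -> (forall k, `|u k - v k| < harmonic k) -> v @ \oo --> 0.
Proof.
move=> u_cvg uv; rewrite -[v](subKr u) -[X in _ --> X](subr0 0).
apply: cvgB => //; apply: norm_cvg0.
apply: (squeeze_cvgr _ (cvg_cst (0 : R)) (@cvg_harmonic R)).
by apply: nearW => k; rewrite normr_ge0 /=; exact: ltW (uv k).
Qed.

(** * Normal cones of locally conic sets *)

Section NormalCones.
Context {R : realType} {l : nat}.
Implicit Types (Omega : set 'rV[R]_l) (y z xi : 'rV[R]_l).

(** This form is transported along homotheties more easily than a witness of
    the little-o. Conversely, such a witness is the positive part of
    [dot xi (z - y)], cut off outside [Omega]: the inequality bounds the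
    inner product from above, and on [Omega] only. *)
Lemma regular_normalP Omega y xi :
  regular_normal_cone Omega y xi <->
  Omega y /\ forall eps : R, 0 < eps ->
    \forall z \near y, Omega z -> dot xi (z - y) <= eps * `|z - y|.
Proof.
split=> -[Oy].
  move=> [r /eqoP ro xir]; split=> // eps eps0.
  near=> z => Oz; apply: (le_trans (xir z Oz)); apply: (le_trans (ler_norm _)).
  rewrite -[X in _ <= _ * X]normr_id; near: z; exact: ro.
move=> xile; split=> //.
exists (fun z => if `[< Omega z >] then Num.max 0 (dot xi (z - y)) else 0).
  apply/eqoP => eps eps0; near=> z; rewrite normr_id.
  have e0 : 0 <= eps * `|z - y| by rewrite mulr_ge0 // ltW.
  case: asboolP => [Oz|_]; last by rewrite normr0.
  rewrite ger0_norm ?le_max ?lexx // ge_max e0 /=.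
  by move: Oz; near: z; exact: xile.
by move=> z Oz; rewrite asboolT // le_max lexx orbT.
Unshelve. all: by end_near. Qed.

Lemma regular_sub_limiting Omega y :
  regular_normal_cone Omega y `<=` limiting_normal_cone Omega y.
Proof.
move=> xi xiN; have [Oy _] := xiN; split=> //.
by exists (fun=> y), (fun=> xi); split=> //; exact: cvg_cst.
Qed.

(** Geometrically: on a ball around [y] the set agrees with the translate by [y]
    of a cone. This says it without the cone, so that finite unions and
    intersections are immediate; the point [y] may lie outside [Omega]. *)
Definition locally_conic Omega y :=
  \forall z \near y, forall s : R, 0 < s <= 1 ->
    Omega z <-> Omega (y + s *: (z - y)).

(** The affine function [dot a - b] has constant sign near [y] unless it
    vanishes at [y]; in that case it is linear in [z - y], and a positive factor
    does not change its sign. *)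
Lemma locally_conic_halfspace (a : 'rV[R]_l) (b : R) y :
  locally_conic [set z | dot a z <= b] y.
Proof.
have dcvg : dot a z @[z --> y] --> dot a y by exact: dot_continuous.
have dilE z (s : R) : dot a (y + s *: (z - y)) =
    dot a y + s * (dot a z - dot a y) by rewrite dotDr dotZr dotBr.
rewrite /locally_conic; case: (ltgtP (dot a y) b) => [lt|gt|eq].
- near=> z => s /andP[s0 s1] /=; rewrite dilE.
  have zb : dot a z < b by near: z; exact: (cvgr_lt _ dcvg).
  by split=> _; nra.
- near=> z => s /andP[s0 s1] /=; rewrite dilE.
  have zb : b < dot a z by near: z; exact: (cvgr_gt _ dcvg).
  by split; nra.
- near=> z => s /andP[s0 s1] /=; rewrite dilE eq.
  by split; nra.
Unshelve. all: by end_near. Qed.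

Lemma locally_conic_forall (I : finType) (A : I -> set 'rV[R]_l) y :
  (forall i, locally_conic (A i) y) ->
  locally_conic [set z | forall i, A i z] y.
Proof.
move=> /filter_forall; apply: filterS => z Az s s01 /=.
by split=> Aall i; apply/(Az i s s01).
Qed.

Lemma locally_conic_exists (I : finType) (A : I -> set 'rV[R]_l) y :
  (forall i, locally_conic (A i) y) ->
  locally_conic (\bigcup_(i in [set: I]) A i) y.
Proof.
move=> /filter_forall; apply: filterS => z Az s s01 /=.
by split=> -[i _ Ai]; exists i => //; apply/(Az i s s01).
Qed.

Lemma locally_conic_polyhedral Omega y :
  convex_polyhedral Omega -> locally_conic Omega y.
Proof.
move=> [p [a [b ->]]].
apply: (@locally_conic_forall _ (fun i => [set z | dot (a i) z <= b i])) => i.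
exact: locally_conic_halfspace.
Qed.

(** A point of [Omega] near the dilated point comes, by undoing the dilation,
    from a point of [Omega] near [z]. The inequality for the latter, multiplied
    by [s] on both sides, is the inequality for the former. *)
Lemma regular_normal_dilation Omega y : locally_conic Omega y ->
  \forall z \near y, forall s : R, 0 < s <= 1 ->
    regular_normal_cone Omega z `<=`
    regular_normal_cone Omega (y + s *: (z - y)).
Proof.
move=> /near_join; apply: filterS => z conic_z s s01 xi.
move=> /regular_normalP[Oz xiz]; have [s0 _] := andP s01.
have s_neq0 : s != 0 by rewrite gt_eqF.
set zs := y + s *: (z - y); pose undil w := y + s^-1 *: (w - y).
have undilK w : y + s *: (undil w - y) = w.
  by rewrite /undil addrAC subrr add0r scalerA divff // scale1r addrC subrK.
have undil_zs : undil zs = z.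
  by rewrite /undil /zs addrAC subrr add0r scalerA mulVf // scale1r addrC subrK.
apply/regular_normalP; split; first exact/(nbhs_singleton conic_z s s01).
move=> eps eps0.
have undil_cvg : undil w @[w --> zs] --> z.
  by rewrite -[X in _ --> X]undil_zs; exact: dilation_continuous.
have near_conic := undil_cvg _ conic_z.
have near_xi := undil_cvg _ (xiz eps eps0).
apply: (@filterS2 _ _ (nbhs_filter zs) _ _ _ _ near_conic near_xi).
move=> w conic_w xiw Ow.
have subE : w - zs = s *: (undil w - z).
  by rewrite -[in LHS](undilK w) /zs opprD addrACA subrr add0r -scalerBr
             opprB addrA subrK.
rewrite subE dotZr normrZ gtr0_norm // mulrCA ler_pM2l //.
by apply: xiw; apply/(conic_w s s01); rewrite undilK.
Qed.

(** The points [y + s (z - y)] with [s = 1 / (k + 1)] share the normal [xi] and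
    tend to [y]. *)
Lemma regular_normal_near Omega y : Omega y -> locally_conic Omega y ->
  \forall z \near y,
    regular_normal_cone Omega z `<=` limiting_normal_cone Omega y.
Proof.
move=> Oy /regular_normal_dilation; apply: filterS => z Nz xi xiz; split=> //.
have h01 k : 0 < (harmonic k : R) <= 1.
  by rewrite harmonic_gt0 /= invf_le1 ?ltr0n // ler1n.
have Nk k := Nz _ (h01 k) xi xiz.
exists (fun k => y + harmonic k *: (z - y)), (fun=> xi); split=> //.
- rewrite -[X in _ --> X]addr0 -(scale0r (z - y)).
  by apply: cvgD; [exact: cvg_cst | apply: cvgZr_tmp; exact: cvg_harmonic].
- exact: cvg_cst.
- by move=> k; have [] := Nk k.
Qed.

End NormalCones.

(** * Approximate stationarity *)

Section Stationarity.
Context {R : realType} {n l : nat}.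
Variables (f : 'rV[R]_n -> R) (F : 'rV[R]_n -> 'rV[R]_l).
Variable Gamma : set 'rV[R]_l.

(** Closeness of the normals is measured after multiplication by [A], so that
    applying this to a different Jacobian for each [k] calls for no uniform
    bound on the Jacobians. *)
Lemma limiting_normal_approx {Omega : set 'rV[R]_l} {y xi : 'rV[R]_l}
    (A : 'M[R]_(l, n)) (e : R) :
  limiting_normal_cone Omega y xi -> 0 < e ->
  exists y' xi' : 'rV[R]_l, [/\ regular_normal_cone Omega y' xi',
    `|y - y'| < e & `|xi *m A - xi' *m A| < e].
Proof.
move=> [_ [yk [xik [yk_cvg xik_cvg _ xikN]]]] e0.
have xiA_cvg : xik k *m A @[k --> \oo] --> xi *m A.
  exact: (cvg_comp _ _ xik_cvg (mulmx_continuous _ _ _ A xi)).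
have /filter_ex[k [? ?]] : \forall k \near \oo,
    `|y - yk k| < e /\ `|xi *m A - xik k *m A| < e.
  apply: filterI; first exact: (cvgr_dist_lt _ _ yk_cvg _ e0).
  exact: (cvgr_dist_lt _ _ xiA_cvg _ e0).
by exists (yk k), (xik k).
Qed.

Lemma regular_stationary_of_limiting xbar x lambda delta eps :
  approx_M_stationary_seq f F Gamma xbar x lambda delta eps ->
  exists lambda' delta' eps',
    approx_S_stationary_seq f F Gamma xbar x lambda' delta' eps'.
Proof.
move=> [x_cvg delta_cvg eps_cvg res lamN].
have approx k := limiting_normal_approx (Jacobian F (x k)) (harmonic k) (lamN k)
  (harmonic_gt0 k).
have [y' /choice[lambda' y'P]] := choice approx.
exists lambda', (fun k => F (x k) - y' k),
  (fun k => gradient f (x k) + lambda' k *m Jacobian F (x k)).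
split=> //.
- apply: cvg0_harmonic_dist delta_cvg _ => k; have [_ lt_h _] := y'P k.
  by rewrite distrC addrAC.
- apply: cvg0_harmonic_dist eps_cvg _ => k; have [_ _ +] := y'P k.
  by rewrite res opprD addrACA subrr add0r.
- by move=> k; rewrite subKr; have [] := y'P k.
Qed.

Lemma eventually_limiting_normal xbar x lambda delta eps :
  F x @[x --> xbar] --> F xbar -> Gamma (F xbar) ->
  locally_conic Gamma (F xbar) ->
  approx_S_stationary_seq f F Gamma xbar x lambda delta eps ->
  \forall k \near \oo, limiting_normal_cone Gamma (F xbar) (lambda k).
Proof.
move=> F_cont feas conic [x_cvg delta_cvg _ _ lamN].
have y_cvg : F (x k) - delta k @[k --> \oo] --> F xbar.
  rewrite -[X in _ --> X]subr0; apply: cvgB => //.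
  exact: (cvg_comp _ _ x_cvg F_cont).
have near_y := y_cvg _ (regular_normal_near _ _ feas conic).
have [N _ N_y] := near_y.
by exists N => // k /N_y; apply.
Qed.

End Stationarity.

Theorem proposition3p7 (R : realType) (n l t : nat)
    (f : 'rV[R]_n -> R) (F : 'rV[R]_n -> 'rV[R]_l)
    (Gammas : 'I_t -> set 'rV[R]_l) (Gamma : set 'rV[R]_l)
    (xbar : 'rV[R]_n)
    (hf : C1_fun f) (hF : C1_map F)
    (hpoly : forall j : 'I_t, convex_polyhedral (Gammas j))
    (hGamma : Gamma = \bigcup_(j in [set: 'I_t]) Gammas j)
    (hfeas : Gamma (F xbar)) :
  ((exists (x : nat -> 'rV[R]_n) (lambda delta : nat -> 'rV[R]_l)
           (eps : nat -> 'rV[R]_n),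
       approx_S_stationary_seq f F Gamma xbar x lambda delta eps)
   <-> AM_stationary f F Gamma xbar)
  /\
  (AM_stationary f F Gamma xbar
   <-> exists (x : nat -> 'rV[R]_n) (lambda : nat -> 'rV[R]_l)
              (eps : nat -> 'rV[R]_n),
         [/\ x @ \oo --> xbar,
             eps @ \oo --> (0 : 'rV[R]_n),
             forall k : nat, lagrange_residual f F (x k) (lambda k) (eps k) &
             forall k : nat, limiting_normal_cone Gamma (F xbar) (lambda k)]).
Proof.
have F_cont : F x @[x --> xbar] --> F xbar.
  by apply: differentiable_continuous; exact: hF.1.
have conic : locally_conic Gamma (F xbar).
  by rewrite hGamma; apply: locally_conic_exists => j;
     exact: locally_conic_polyhedral.
have M_S : AM_stationary f F Gamma xbar -> exists x lambda delta eps,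
    approx_S_stationary_seq f F Gamma xbar x lambda delta eps.
  by move=> [x [la [de [ep /regular_stationary_of_limiting]]]]; exists x.
split; split=> //.
- move=> [x [la [de [ep [x_cvg de_cvg ep_cvg res laN]]]]].
  exists x, la, de, ep; split=> // k; exact: regular_sub_limiting.
- move=> /M_S[x [la [de [ep S_seq]]]].
  (* shifting the sequence by N drops the terms whose base point is still far
     from [F xbar] *)
  have [N _ laN] :=
    eventually_limiting_normal _ _ _ _ _ _ _ _ F_cont hfeas conic S_seq.
  have [x_cvg _ ep_cvg res _] := S_seq.
  exists (fun k => x (k + N)%N), (fun k => la (k + N)%N),
    (fun k => ep (k + N)%N).
  split.
  + by rewrite (cvg_shiftn N x).
  + by rewrite (cvg_shiftn N ep).
  + by move=> k; exact: res.
  + by move=> k; apply: laN => /=; exact: leq_addl.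
- move=> [x [la [ep [x_cvg ep_cvg res laN]]]].
  exists x, la, (fun k => F (x k) - F xbar), ep; split=> //.
    rewrite -(subrr (F xbar)); apply: cvgB; last exact: cvg_cst.
    exact: (cvg_comp _ _ x_cvg F_cont).
  by move=> k; rewrite subKr.
Qed.
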